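(* (i) $w_0(t)=1$ and for all $n\geq 0$, $w_{n+1}(t)=t\sum_{k=0}^n w_k(t^{-1})\,w_{n-k}(t^{-1})$. (ii) The generating series $W=\sum_{n\geq 0}w_n(t)x^n\in\left(\mathbb{Q}[t,t^{-1}]\right)[[x]]$ satisfies $t(1+tx)-tW+2tx^2W^2+x^3W^4=0$.
   Context: For $n\geq 0$ let $P_n$ be a strictly convex polygon with $n+2$ vertices and a marked boundary edge $e_*$. A triangulation of $P_n$ is a decomposition into $n$ non-overlapping triangles with vertices among those of $P_n$. For $n\geq1$, its checkerboard colouring colours each triangle black or white such that the unique triangle containing $e_*$ is black and triangles sharing an edge have different colours; $n_b(\tau),n_w(\tau)$ denote the numbers of black and white triangles of the triangulation $\tau$. Define the Laurent polynomial $w_n(t)=\sum_{\tau}t^{n_b(\tau)-n_w(\tau)}$, the sum over all triangulations $\tau$ of $P_n$; by convention $w_0(t)=1$ (the degenerate polygon $P_0$ has a unique triangulation with no triangles). *)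

(* Defs.v *)
From HB Require Import structures.
From mathcomp Require Import all_boot all_order all_algebra.
From mathcomp Require Import boolp.
From mathcomp.finmap Require Import finmap.
From mathcomp.multinomials Require Import monalg.

Set Implicit Arguments.
Unset Strict Implicit.
Unset Printing Implicit Defensive.

Import Order.TTheory GRing.Theory Num.Theory.

Local Open Scope ring_scope.

(** * The ring Q[t, t^-1] *)

(* A Laurent polynomial is a finitely supported map int -> rat, its value at k
   being the coefficient of t^k. The library puts a ring structure on
   {malg rat[K]} only for monoids K without nontrivial units, which excludes
   int, so the convolution product is defined here. *)
Definition laurent : Type := {malg rat[int]}.

HB.instance Definition _ := GRing.Lmodule.on laurent.

Definition texp (k : int) : laurent := << k >>.

Definition lmul (f g : laurent) : laurent :=
  \sum_(i <- msupp f) \sum_(j <- msupp g) << f@_i * g@_j *g (i + j)%R >>.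

Lemma lmul_widen (f g : laurent) (A B : {fset int}) :
  fsubset (msupp f) A -> fsubset (msupp g) B ->
  lmul f g = \sum_(i <- A) \sum_(j <- B) << f@_i * g@_j *g (i + j)%R >>.
Proof.
move=> fA gB.
transitivity (\sum_(i <- msupp f) \sum_(j <- B)
                << f@_i * g@_j *g (i + j)%R >> : laurent).
  apply: eq_bigr => i _; apply: big_fset_incl gB _ => j _ /mcoeff_outdom ->.
  by rewrite mulr0 monalgU0.
apply: big_fset_incl fA _ => i _ /mcoeff_outdom ->.
by rewrite big1 // => j _; rewrite mul0r monalgU0.
Qed.

Lemma lmulC : commutative lmul.
Proof.
move=> f g; rewrite /lmul exchange_big; apply: eq_bigr => j _.
by apply: eq_bigr => i _; rewrite mulrC addrC.
Qed.

Lemma lmulDl : left_distributive lmul +%R.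
Proof.
move=> f g h; pose A := fsetU (msupp f) (msupp g).
rewrite (@lmul_widen (f + g) h A (msupp h)) ?fsubset_refl ?msuppD_le //.
rewrite (@lmul_widen f h A (msupp h)) ?fsubset_refl ?fsubsetUl //.
rewrite (@lmul_widen g h A (msupp h)) ?fsubset_refl ?fsubsetUr //.
rewrite -big_split; apply: eq_bigr => i _; rewrite -big_split.
by apply: eq_bigr => j _; rewrite mcoeffD mulrDl monalgUD.
Qed.

Lemma lmulDr : right_distributive lmul +%R.
Proof. by move=> f g h; rewrite lmulC lmulDl !(lmulC f). Qed.

Lemma lmul0l : left_zero 0 lmul.
Proof. by move=> f; rewrite /lmul msupp0 big_seq_fset0. Qed.

Lemma lmulUU (a b : rat) (i j : int) :
  lmul << a *g i >> << b *g j >> = << a * b *g (i + j)%R >>.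
Proof.
rewrite (@lmul_widen _ _ [fset i]%fset [fset j]%fset) ?msuppU_le //.
by rewrite !big_seq_fset1 !mcoeffUU.
Qed.

Lemma lmul_suml (I : Type) (r : seq I) (F : I -> laurent) g :
  lmul (\sum_(i <- r) F i) g = \sum_(i <- r) lmul (F i) g.
Proof. exact: (big_morph (lmul^~ g) (fun x y => lmulDl x y g) (lmul0l g)). Qed.

Lemma lmul_sumr (I : Type) (r : seq I) (F : I -> laurent) g :
  lmul g (\sum_(i <- r) F i) = \sum_(i <- r) lmul g (F i).
Proof. by rewrite lmulC lmul_suml; apply: eq_bigr => i _; rewrite lmulC. Qed.

Lemma laurent_sumE f :
  exists r : seq (rat * int), f = \sum_(a <- r) << a.1 *g a.2 >> :> laurent.
Proof.
exists [seq (f@_k, k) | k <- msupp f].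
by rewrite big_map [LHS]monalgE.
Qed.

Lemma lmulA : associative lmul.
Proof.
move=> f g h.
have [[r ->] [[r' ->] [s ->]]] :=
  (conj (laurent_sumE f) (conj (laurent_sumE g) (laurent_sumE h))).
rewrite [LHS]lmul_suml [X in _ = lmul X _]lmul_suml [RHS]lmul_suml.
apply: eq_bigr => a _; rewrite [X in lmul _ X = _]lmul_suml.
rewrite [LHS]lmul_sumr [X in _ = lmul X _]lmul_sumr [RHS]lmul_suml.
apply: eq_bigr => b _; rewrite [X in lmul _ X = _]lmul_sumr [LHS]lmul_sumr.
rewrite [RHS]lmul_sumr; apply: eq_bigr => c _.
by rewrite !lmulUU mulrA addrA.
Qed.

Lemma lmul1 : left_id (texp 0) lmul.
Proof.
move=> f; have [r ->] := laurent_sumE f.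
rewrite lmul_sumr; apply: eq_bigr => a _.
by rewrite lmulUU mul1r add0r.
Qed.

Lemma texp0_neq0 : texp 0 != 0.
Proof. by rewrite monalgU_eq0 oner_eq0. Qed.

HB.instance Definition _ := GRing.Zmodule_isComNzRing.Build laurent
  lmulA lmulC lmul1 lmulDl texp0_neq0.

(* The substitution f(t) |-> f(t^-1). *)
Definition tinv (f : laurent) : laurent :=
  \sum_(k <- msupp f) << f@_k *g (- k)%R >>.

(** * Formal power series *)

Definition fps (A : Type) : Type := nat -> A.

HB.instance Definition _ (A : choiceType) := Choice.copy (fps A) (nat -> A).

Section FormalPowerSeries.
Context {A : comNzRingType}.
Implicit Types f g h : fps A.

Definition fpsC (c : A) : fps A := fun n => if n is 0%N then c else 0.
Definition fpsX : fps A := fun n => (n == 1%N)%:R.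

Definition fps_opp f : fps A := fun n => - f n.
Definition fps_add f g : fps A := fun n => f n + g n.
Definition fps_mul f g : fps A := fun n => \sum_(i < n.+1) f i * g (n - i)%N.

Lemma fps_addA : associative fps_add.
Proof. by move=> f g h; apply: funext => n; rewrite /fps_add addrA. Qed.

Lemma fps_addC : commutative fps_add.
Proof. by move=> f g; apply: funext => n; rewrite /fps_add addrC. Qed.

Lemma fps_add0 : left_id (fpsC 0) fps_add.
Proof. by move=> f; apply: funext => -[|n]; rewrite /fps_add add0r. Qed.

Lemma fps_addN : left_inverse (fpsC 0) fps_opp fps_add.
Proof. by move=> f; apply: funext => -[|n]; rewrite /fps_add addNr. Qed.

HB.instance Definition _ := GRing.isZmodule.Build (fps A)
  fps_addA fps_addC fps_add0 fps_addN.

Lemma fps_mul_trunc f g N n : (n < N)%N ->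
  fps_mul f g n = ((\poly_(i < N) f i) * (\poly_(i < N) g i))`_n.
Proof.
move=> ltnN; rewrite coefM; apply: eq_bigr => i _.
by rewrite !coef_poly (leq_ltn_trans (leq_subr _ _) ltnN)
           (leq_ltn_trans (leq_ord i) ltnN).
Qed.

Lemma fps_mulC : commutative fps_mul.
Proof.
by move=> f g; apply: funext => n; rewrite !(@fps_mul_trunc _ _ n.+1) // mulrC.
Qed.

Lemma fps_mulA : associative fps_mul.
Proof.
move=> f g h; apply: funext => n; pose p f := \poly_(i < n.+1) f i : {poly A}.
transitivity ((p f * (p g * p h))`_n).
  rewrite coefM; apply: eq_bigr => i _.
  by rewrite -fps_mul_trunc ?ltnS ?leq_subr // coef_poly ltn_ord.
rewrite mulrA coefM; apply: eq_bigr => i _.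
by rewrite -fps_mul_trunc // coef_poly ltnS leq_subr.
Qed.

Lemma fps_mul1 : left_id (fpsC 1) fps_mul.
Proof.
move=> f; apply: funext => n; rewrite /fps_mul big_ord_recl mul1r subn0.
by rewrite big1 ?addr0 // => i _; rewrite mul0r.
Qed.

Lemma fps_mulDl : left_distributive fps_mul fps_add.
Proof.
move=> f g h; apply: funext => n; rewrite /fps_mul /fps_add -big_split.
by apply: eq_bigr => i _; rewrite mulrDl.
Qed.

Lemma fps_oner_neq0 : fpsC 1 != 0.
Proof.
by apply/eqP => /(congr1 (fun f : fps A => f 0%N))/eqP; rewrite oner_eq0.
Qed.

HB.instance Definition _ := GRing.Zmodule_isComNzRing.Build (fps A)
  fps_mulA fps_mulC fps_mul1 fps_mulDl fps_oner_neq0.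

End FormalPowerSeries.

(** * Triangulations of strictly convex polygons *)

(* A polygon with n.+2 vertices and a marked boundary edge is given by its
   vertices in counterclockwise order, numbered so that the marked edge joins
   the last vertex to the first one. *)

Section Polygon.
Context {R : realFieldType}.

(* Twice the signed area of the triangle a b c; it is positive when a, b, c
   are in counterclockwise order. *)
Definition orient (a b c : 'rV[R]_2) : R :=
  (b 0 0 - a 0 0) * (c 0 1 - a 0 1) - (b 0 1 - a 0 1) * (c 0 0 - a 0 0).

Definition strictly_convex n (p : 'I_n.+2 -> 'rV[R]_2) : Prop :=
  forall i j k : 'I_n.+2, (i < j)%N -> (j < k)%N -> 0 < orient (p i) (p j) (p k).

Definition hull n (p : 'I_n.+2 -> 'rV[R]_2) (S : {set 'I_n.+2})
    (x : 'rV[R]_2) : Prop :=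
  exists l : 'I_n.+2 -> R,
    [/\ forall i, i \in S -> 0 <= l i,
        \sum_(i in S) l i = 1 & x = \sum_(i in S) l i *: p i].

(* The topological interior of the hull, when the p i for i in S are the
   vertices of a nondegenerate triangle. *)
Definition hull_interior n (p : 'I_n.+2 -> 'rV[R]_2) (S : {set 'I_n.+2})
    (x : 'rV[R]_2) : Prop :=
  exists l : 'I_n.+2 -> R,
    [/\ forall i, i \in S -> 0 < l i,
        \sum_(i in S) l i = 1 & x = \sum_(i in S) l i *: p i].

(* A triangle is identified with the set of its three vertices. *)
Definition is_triangulation n (p : 'I_n.+2 -> 'rV[R]_2)
    (T : {set {set 'I_n.+2}}) : Prop :=
  [/\ forall s, s \in T -> #|s| = 3,
      #|T| = n,
      forall s s', s \in T -> s' \in T -> s != s' ->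
        forall x, ~ (hull_interior p s x /\ hull_interior p s' x)
    & forall x, hull p [set: 'I_n.+2] x <-> exists2 s, s \in T & hull p s x].

End Polygon.

(* B is the set of black triangles of T. Two distinct triangles share an edge
   when they have exactly two common vertices. *)
Definition is_checkerboard n (T B : {set {set 'I_n.+2}}) : bool :=
  [&& B \subset T,
      [forall s in T, ([set ord0; ord_max] \subset s) ==> (s \in B)] &
      [forall s in T, forall s' in T,
         (#|s :&: s'| == 2) ==> ((s \in B) != (s' \in B))]].

(* A triangulation of a polygon with at least three vertices has exactly one
   checkerboard colouring, so the choice and the default value are immaterial. *)
Definition black n (T : {set {set 'I_n.+2}}) : {set {set 'I_n.+2}} :=
  odflt set0 [pick B | is_checkerboard T B].

Definition nb n (T : {set {set 'I_n.+2}}) : nat := #|black T|.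
Definition nw n (T : {set {set 'I_n.+2}}) : nat := #|T :\: black T|.

(* The degenerate polygon with two vertices is treated separately, because the
   empty set of triangles does not cover it. *)
Definition wpoly (R : realFieldType) n (p : 'I_n.+2 -> 'rV[R]_2) : laurent :=
  if n is 0%N then 1 else
  \sum_(T : {set {set 'I_n.+2}} | `[< is_triangulation p T >])
    texp ((nb T)%:Z - (nw T)%:Z).

(* Main.v *)
Require Import Defs.
From mathcomp Require Import all_boot all_order all_algebra.
From mathcomp Require Import boolp zify ring lra.
From mathcomp.finmap Require Import finmap.
From mathcomp.multinomials Require Import monalg.

(* Two distinct triangles on the vertices of a strictly convex polygon have disjoint
   interiors if and only if no chord of one crosses a chord of the other. A
   noncrossing set of triangles on the vertices a, ..., b has at most b - a - 1
   elements, and equality forces it to contain a triangle {a, k, b}; this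
   triangle cuts it into noncrossing sets of maximal size on a, ..., k and
   k, ..., b. Hence the triangulations are exactly the noncrossing sets of n
   triangles, and removing the triangle at the marked edge gives the
   convolution in (i), the colours of the two remaining parts being exchanged.
   Writing V for W with t replaced by t^-1, (i) says W = 1 + t x V^2 and
   V = 1 + t^-1 x W^2, and eliminating V gives (ii). *)

Set Implicit Arguments.
Unset Strict Implicit.
Unset Printing Implicit Defensive.

Import Order.TTheory GRing.Theory Num.Theory.
Local Open Scope ring_scope.

(** * Laurent polynomials and power series *)

Lemma mcoeff_tinv (f : laurent) k : (tinv f)@_k = f@_(- k).
Proof.
rewrite /tinv raddf_sum /=; under eq_bigr => i _ do rewrite mcoeffU eqr_oppLR.
have [kf|kf] := boolP (- k \in msupp f).
  rewrite (big_fsetD1 (- k)) //= eqxx mulr1n big1_fset ?addr0 // => i.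
  by rewrite !inE => /andP[/negPf-> _] _.
rewrite (mcoeff_outdom kf) big1_fset // => i i_f _.
by case: eqVneq i_f kf => // -> ->.
Qed.

Lemma tinvK : involutive tinv.
Proof. by move=> f; apply/malgP => k; rewrite !mcoeff_tinv opprK. Qed.

Lemma tinvD : {morph tinv : f g / f + g}.
Proof. by move=> f g; apply/malgP => k; rewrite mcoeffD !mcoeff_tinv mcoeffD. Qed.

Lemma tinv0 : tinv 0 = 0.
Proof. by apply/malgP => k; rewrite mcoeff_tinv !mcoeff0. Qed.

Lemma tinv_sum (I : Type) (r : seq I) (Q : pred I) (F : I -> laurent) :
  tinv (\sum_(i <- r | Q i) F i) = \sum_(i <- r | Q i) tinv (F i).
Proof. exact: (big_morph tinv tinvD tinv0). Qed.

Lemma tinvU (c : rat) (k : int) : tinv << c *g k >> = << c *g - k >>.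
Proof. by apply/malgP => i; rewrite mcoeff_tinv !mcoeffU eqr_oppLR. Qed.

Lemma texpD (i j : int) : texp (i + j) = texp i * texp j.
Proof. by rewrite [RHS]lmulUU mulr1. Qed.

(** By bilinearity it suffices to compare monomials, where negation of exponents is additive. *)
Lemma tinvM : {morph tinv : f g / f * g}.
Proof.
move=> f g; have [r ->] := laurent_sumE f; have [s ->] := laurent_sumE g.
rewrite mulr_suml !tinv_sum mulr_suml; apply: eq_bigr => a _.
rewrite !mulr_sumr tinv_sum; apply: eq_bigr => b _.
by rewrite [_ * _]lmulUU !tinvU [RHS]lmulUU opprD.
Qed.

Lemma tinv1 : tinv 1 = 1.
Proof. by rewrite [LHS]tinvU oppr0. Qed.

Section FPS.
Context {A : comNzRingType}.
Implicit Types (f : fps A) (c d : A).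

Lemma fpsC_mulE c f n : (fpsC c * f) n = c * f n.
Proof.
rewrite [LHS]big_ord_recl /= subn0 big1 ?addr0 // => i _.
by rewrite mul0r.
Qed.

Lemma fpsX_mulE f n : (fpsX * f) n = if n is m.+1 then f m else 0.
Proof.
case: n => [|n]; first by rewrite [LHS]big_ord1 mul0r.
rewrite [LHS]big_ord_recl mul0r add0r big_ord_recl mul1r big1 ?addr0 ?subSS ?subn0 //.
by move=> i _; rewrite mul0r.
Qed.

Lemma fpsCM c d : fpsC (c * d) = fpsC c * fpsC d.
Proof. by apply: funext => -[|n]; rewrite fpsC_mulE //= mulr0. Qed.

(** The recurrence is the functional equation read coefficient by coefficient; the factor [fpsX]
    produces the index shift. *)
Lemma fps_quadratic c f (g : fps A) :
    f 0%N = 1 -> (forall n, f n.+1 = c * \sum_(k < n.+1) g k * g (n - k)%N) ->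
  f = 1 + fpsC c * (fpsX * (g * g)).
Proof.
move=> f0 fS; apply: funext => n.
rewrite [RHS](_ : _ = (1 : fps A) n + (fpsC c * (fpsX * (g * g))) n) //.
rewrite fpsC_mulE fpsX_mulE; case: n => [|n]; first by rewrite mulr0 addr0.
by rewrite fS [in RHS](_ : (1 : fps A) n.+1 = 0) ?add0r.
Qed.
End FPS.

(** Multiplying the second equation by [t] gives [t * V = t + x * W ^+ 2], free of [t']. Since
    [t * W = t + x * (t * V) ^+ 2], substituting and expanding the square yields the quartic. *)
Lemma fps_quartic (K : comPzRingType) (t t' x W V : K) :
  t * t' = 1 -> W = 1 + t * (x * (V * V)) -> V = 1 + t' * (x * (W * W)) ->
  t * (1 + t * x) - t * W + 2 * t * x ^+ 2 * W ^+ 2 + x ^+ 3 * W ^+ 4 = 0.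
Proof.
move=> tt' EW EV.
have -> : t * W = t * (1 + t * (x * (V * V))) by rewrite -EW.
have -> : t * (1 + t * (x * (V * V))) = t + x * (t * V) ^+ 2 by ring.
have -> : t * V = t + x * W ^+ 2.
  by rewrite [in LHS]EV mulrDr mulrA tt'; ring.
by ring.
Qed.

(** * Noncrossing sets of triangles *)

Section Dissection.
Context {n : nat}.
Implicit Types (a b i j k m : 'I_n.+2) (s : {set 'I_n.+2}).
Implicit Types (T B : {set {set 'I_n.+2}}).

Definition itv a b : {set 'I_n.+2} := [set i : 'I_n.+2 | (a <= i <= b)%N].

(** Only the interleaving that starts with a vertex of [s] is recorded, so the relation is not
    symmetric; [noncrossing] recovers symmetry by quantifying over ordered pairs. *)
Definition crossing s s' : Prop :=
  exists i j u v, [/\ i \in s, j \in s, u \in s', v \in s' & (i < u)%N && (u < j < v)%N].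

Definition noncrossing T : Prop :=
  forall s s', s \in T -> s' \in T -> ~ crossing s s'.

Definition triangles_in a b T : Prop :=
  forall s, s \in T -> #|s| = 3 /\ s \subset itv a b.

(** Combinatorial model of a triangulation of the subpolygon on [a], ..., [b] with base edge [a b].
    For consecutive [a] and [b] the required size is 0, the degenerate polygon. *)
Definition dissection a b T : Prop :=
  [/\ triangles_in a b T, noncrossing T & #|T| = (b - a).-1].

Definition inside i j T : {set {set 'I_n.+2}} := [set s in T | s \subset itv i j].

Lemma card_triangle i j k : (i < j < k)%N -> #|[set i; j; k]| = 3.
Proof.
move=> ijk; rewrite setUC cardsU1 cards2 !inE.
have -> : i != j by apply/eqP => /(congr1 val) /=; lia.
have -> // : ~~ ((k == i) || (k == j)).
by apply/norP; split; apply/eqP => /(congr1 val) /=; lia.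
Qed.

Lemma sub_triangle i j k s : (i < j < k)%N -> #|s| = 3 -> s \subset [set i; j; k] ->
  s = [set i; j; k].
Proof. by move=> ijk s3 sS; apply/eqP; rewrite eqEcard sS card_triangle ?s3. Qed.

Lemma triangle_not_pair i j s : #|s| = 3 -> ~~ (s \subset [set i; j]).
Proof.
move=> s3; apply/negP => /subset_leq_card; rewrite s3 cards2.
by case: (i != j).
Qed.

Lemma card3_sorted s : #|s| = 3 -> exists i j k, (i < j < k)%N /\ s = [set i; j; k].
Proof.
move=> s3; have [i [is_ imin]] : exists i, i \in s /\ forall m, m \in s -> (i <= m)%N.
  have [m ms] : exists m, m \in s by apply/set0Pn; rewrite -card_gt0 s3.
  by case: (@arg_minnP _ m (mem s) (@nat_of_ord _)) => // i ? h; exists i.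
have [k [ks kmax]] : exists k, k \in s /\ forall m, m \in s -> (m <= k)%N.
  by case: (@arg_maxnP _ i (mem s) (@nat_of_ord _)) => // k ? h; exists k.
have /subsetPn[j js] := triangle_not_pair i k s3; rewrite !inE => /norP[ji jk].
have ijk : (i < j < k)%N.
  have := imin j js; have := kmax j js; move: ji jk; rewrite -!val_eqE /=; lia.
exists i, j, k; split => //; apply/esym/eqP; rewrite eqEcard card_triangle // s3.
by rewrite andbT; apply/subsetP => m; rewrite !inE -orbA => /or3P[]/eqP->.
Qed.

(** A vertex [v] of [s'] outside the range [i..j] and a vertex [m] strictly inside it would span a
    chord crossing [i j]. Which of the two crossings arises depends on the side on which [v]
    lies. *)
Lemma chord_split s s' i j : i \in s -> j \in s ->
    ~ crossing s s' -> ~ crossing s' s ->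
  s' \subset itv i j \/ forall m, m \in s' -> ~~ (i < m < j)%N.
Proof.
move=> is_ js ss' s's; case: (boolP (s' \subset itv i j)); first by left.
move=> /subsetPn[v vs']; rewrite inE => vN; right=> m ms'; apply/negP => imj.
have [vi|iv] := ltnP v i.
  by apply: s's; exists v, m, i, j; split => //; lia.
by apply: ss'; exists i, j, m, v; split => //; lia.
Qed.

Lemma itvW i j i' j' s : (i' <= i)%N -> (j <= j')%N ->
  s \subset itv i j -> s \subset itv i' j'.
Proof.
move=> ii jj; move/subset_trans; apply; apply/subsetP => m; rewrite !inE; lia.
Qed.

Lemma sub_itvP i j s :
  reflect (forall m, m \in s -> (i <= m <= j)%N) (s \subset itv i j).
Proof. by apply: (iffP subsetP) => h m /h; rewrite inE. Qed.

(** Take [k] to be the largest vertex below [b] joined to [a] by a triangle of [T]. No triangle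
    crosses the chord [a k]. By maximality, a triangle at [a] that leaves [a..k] has no vertices
    other than [a], [k], [b]. *)
Lemma fan_split a b T s : (a < b)%N -> triangles_in a b T -> noncrossing T ->
    s \in T -> a \in s ->
  exists2 k : 'I_n.+2, (a < k < b)%N & forall s', s' \in T ->
    s' = [set a; k; b] \/ s' \subset itv a k \/ s' \subset itv k b.
Proof.
move=> ab Tab ncT sT as_.
have [k [s1 [akb [s1T as1 ks1] kmax]]] : exists k s1,
    [/\ (a < k < b)%N, [/\ s1 \in T, a \in s1 & k \in s1] &
       forall m s', (a < m < b)%N -> s' \in T -> a \in s' -> m \in s' -> (m <= k)%N].
  pose Q k := (a < k < b)%N && [exists s in T, (a \in s) && (k \in s)].
  have [k0 k0Q] : exists k, Q k.
    have [s3 /sub_itvP sab] := Tab s sT.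
    have /subsetPn[k ks] := triangle_not_pair a b s3; rewrite !inE => /norP[ka kb].
    exists k; apply/andP; split; last by apply/exists_inP; exists s; rewrite ?as_.
    by have := sab k ks; move: ka kb; rewrite -!val_eqE /=; lia.
  have [k /andP[akb /exists_inP[s1 s1T /andP[as1 ks1]]] kmax] :=
    @arg_maxnP _ k0 Q (@nat_of_ord _) k0Q.
  exists k, s1; split=> // m s' amb s'T as' ms'; apply: kmax.
  by rewrite /Q amb; apply/exists_inP; exists s'; rewrite ?as'.
exists k => // s' s'T; have [s3 /sub_itvP s'ab] := Tab s' s'T.
have [] := chord_split as1 ks1 (ncT _ _ s1T s'T) (ncT _ _ s'T s1T).
  by right; left.
move=> nak; have [as'|as'] := boolP (a \in s').
  left; apply: sub_triangle => //; apply/subsetP => m ms'.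
  have : (m == a) || (k <= m)%N.
    by have := nak m ms'; have := s'ab m ms'; rewrite -val_eqE /=; lia.
  rewrite !inE; case: eqVneq => //= ma km; case: (ltnP m b) => mb.
    have mk : (m <= k)%N by apply: kmax s'T as' ms'; lia.
    by apply/orP; left; apply/eqP/val_inj => /=; lia.
  apply/orP; right; apply/eqP/val_inj => /=; have := s'ab m ms'; lia.
right; right; apply/sub_itvP => m ms'.
have ma : m != a by apply: contraNneq as' => <-.
by have := nak m ms'; have := s'ab m ms'; move: ma; rewrite -val_eqE /=; lia.
Qed.

Lemma noncrossing_sub T T' : T' \subset T -> noncrossing T -> noncrossing T'.
Proof. by move=> /subsetP sub nc s s' /sub sT /sub s'T; apply: nc. Qed.

Lemma inside_sub i j T : inside i j T \subset T.
Proof. by apply/subsetP => s; rewrite inE => /andP[]. Qed.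

Lemma triangles_inside a b i j T : triangles_in a b T -> triangles_in i j (inside i j T).
Proof. by move=> Tab s; rewrite inE => /andP[/Tab[]]. Qed.

(** Induction on [b - a]. If some triangle contains [a], [fan_split] bounds the size by
    [(k - a - 1) + (b - k - 1)], plus 1 exactly when [[set a; k; b]] is present. *)
Lemma noncrossing_card a b T : (a < b)%N -> triangles_in a b T -> noncrossing T ->
  (#|T| <= (b - a).-1)%N /\
  (#|T| = (b - a).-1 -> (a.+1 < b)%N ->
     exists2 k : 'I_n.+2, (a < k < b)%N & [set a; k; b] \in T).
Proof.
have [d] := ubnP (b - a)%N; elim: d => // d IH in a b T *.
move=> abd ab Tab ncT; have [ab1|ab1] := leqP b a.+1.
  have -> : T = set0.
    apply/setP => s; rewrite inE; apply/negP => /Tab[s3 /sub_itvP sab].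
    have /subsetPn[m ms] := triangle_not_pair a b s3; rewrite !inE -!val_eqE /=.
    by have := sab m ms; lia.
  by rewrite cards0; split=> //; lia.
have [/exists_inP[s sT as_]|/exists_inP noa] := boolP [exists s in T, a \in s].
  have [k akb Tsplit] := fan_split ab Tab ncT sT as_.
  have [|||| Tak _] := IH a k (inside a k T); try lia.
  - exact: triangles_inside Tab.
  - exact: noncrossing_sub (inside_sub _ _ _) ncT.
  have [|||| Tkb _] := IH k b (inside k b T); try lia.
  - exact: triangles_inside Tab.
  - exact: noncrossing_sub (inside_sub _ _ _) ncT.
  have := (leq_card_setU (inside a k T) (inside k b T)).1.
  have [akbT|akbT] := boolP ([set a; k; b] \in T).
    have /subset_leq_card : T \subset [set a; k; b] |: (inside a k T :|: inside k b T).
      apply/subsetP => s' s'T; rewrite !inE s'T /=.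
      by case: (Tsplit _ s'T) => [->|[|]->]; rewrite ?eqxx ?orbT.
    rewrite cardsU1 => h1 h2; split; last by exists k.
    apply: leq_trans h1 _.
    apply: leq_trans (leq_add (leq_b1 _) (leq_trans h2 (leq_add Tak Tkb))) _; lia.
  have /subset_leq_card h1 : T \subset inside a k T :|: inside k b T.
    apply/subsetP => s' s'T; rewrite !inE s'T /=.
    by case: (Tsplit _ s'T) => [Es|[|]->]; rewrite ?orbT //; move: akbT; rewrite -Es s'T.
  move=> h2; have := leq_trans h1 (leq_trans h2 (leq_add Tak Tkb)).
  by move: #|T| => c; split; lia.
(* No triangle contains [a], so [T] lives on [a+1..b]; the bound drops by one and equality cannot
   occur. *)
have a1n : (a.+1 < n.+2)%N by apply: leq_trans ab1 _; rewrite ltnW.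
have [|||h _] := IH (Ordinal a1n) b T _ _ _ ncT; rewrite /=; try lia.
- move=> s sT; have [s3 /sub_itvP sab] := Tab s sT; split=> //.
  apply/sub_itvP => m ms /=; have := sab m ms.
  have : m != a by apply: contra_notN noa => /eqP <-; exists s.
  by rewrite -val_eqE /=; lia.
by move: h => /= h; split; lia.
Qed.

Definition glue a k b T1 T2 : {set {set 'I_n.+2}} := [set a; k; b] |: (T1 :|: T2).

(** No triangle crosses the sides [a k] and [k b] of the apex triangle, so each other triangle falls
    on one side. *)
Lemma dissection_split a k b T : (a < k < b)%N -> dissection a b T ->
    [set a; k; b] \in T ->
  [/\ dissection a k (inside a k T), dissection k b (inside k b T)
    & T = glue a k b (inside a k T) (inside k b T)].
Proof.
move=> akb [Tab ncT cT] sT.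
have [as_ ks bs] : [/\ a \in [set a; k; b], k \in [set a; k; b] & b \in [set a; k; b]].
  by rewrite !inE !eqxx !orbT.
have TE : T = glue a k b (inside a k T) (inside k b T).
  apply/eqP; rewrite eqEsubset; apply/andP; split; apply/subsetP => s' ; last first.
    by rewrite !inE => /or3P[/eqP-> //|/andP[]|/andP[]].
  move=> s'T; rewrite !inE s'T /=; have [s3 /sub_itvP s'ab] := Tab s' s'T.
  have [->|h1] := chord_split as_ ks (ncT _ _ sT s'T) (ncT _ _ s'T sT).
    by rewrite orbT.
  have [->|h2] := chord_split ks bs (ncT _ _ sT s'T) (ncT _ _ s'T sT).
    by rewrite !orbT.
  apply/orP; left; apply/eqP/sub_triangle => //; apply/subsetP => m ms'.
  rewrite !inE -!val_eqE /=.
  by have := h1 m ms'; have := h2 m ms'; have := s'ab m ms'; lia.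
have ncak := noncrossing_sub (inside_sub a k T) ncT.
have nckb := noncrossing_sub (inside_sub k b T) ncT.
have tak : triangles_in a k (inside a k T) := triangles_inside Tab.
have tkb : triangles_in k b (inside k b T) := triangles_inside Tab.
have [|cak _] := noncrossing_card _ tak ncak; first by lia.
have [|ckb _] := noncrossing_card _ tkb nckb; first by lia.
have := (leq_card_setU (inside a k T) (inside k b T)).1.
have : (#|T| <= 1 + #|inside a k T :|: inside k b T|)%N.
  by rewrite {1}TE cardsU1 leq_add2r leq_b1.
rewrite cT => h1 h2; have {h1 h2} := leq_trans h1 (leq_add (leqnn 1) h2).
(* The upper bounds for the two sides and the apex triangle add up to the size of [T], so both
   bounds are attained. *)
move: cak ckb => cak ckb h; split=> //; split=> //; apply/eqP; rewrite eqn_leq ?cak ?ckb.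
  by have := leq_trans h (leq_add (leqnn 1) (leq_add (leqnn _) ckb)); lia.
by have := leq_trans h (leq_add (leqnn 1) (leq_add cak (leqnn _))); lia.
Qed.

Lemma dissection_apex a b T : (a.+1 < b)%N -> dissection a b T ->
  exists2 k : 'I_n.+2, (a < k < b)%N & [set a; k; b] \in T.
Proof.
move=> ab [Tab ncT cT]; have [|_] := noncrossing_card _ Tab ncT; first by lia.
exact.
Qed.

(** For [k < k'] the chords [a k'] and [k b] would cross. *)
Lemma dissection_apex_uniq a b k k' T : dissection a b T ->
    (a < k < b)%N -> (a < k' < b)%N ->
    [set a; k; b] \in T -> [set a; k'; b] \in T ->
  k = k'.
Proof.
move=> [_ ncT _]; wlog: k k' / (k <= k')%N => [W|kk' h h' kT k'T].
  case: (leqP k k') => [|/ltnW] kk' h h' kT k'T; first exact: W.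
  by apply/esym; apply: W.
apply/val_inj/eqP; rewrite eqn_leq kk' /= leqNgt; apply/negP => ltkk'.
apply: (ncT _ _ k'T kT); exists a, k', k, b; split; rewrite ?inE ?eqxx ?orbT //; lia.
Qed.

Lemma dissection_edge a b T : b = a.+1 :> nat -> dissection a b T <-> T = set0.
Proof.
move=> ab; split=> [[_ _ cT]|->]; first by apply/eqP; rewrite -cards_eq0 cT; lia.
by split=> [s|s s'|]; rewrite ?inE // cards0; lia.
Qed.

(** * Gluing families of triangles on both sides of an apex triangle *)

Section Glue.
Context (a k b : 'I_n.+2) (T1 T2 : {set {set 'I_n.+2}}).
Hypothesis akb : (a < k < b)%N.
Hypotheses (tri1 : triangles_in a k T1) (tri2 : triangles_in k b T2).

Lemma apex_notin : ([set a; k; b] \notin T1) /\ ([set a; k; b] \notin T2).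
Proof.
split; apply/negP.
  by move=> /tri1[_ /sub_itvP h]; have := h b; rewrite !inE eqxx orbT => /(_ isT); lia.
by move=> /tri2[_ /sub_itvP h]; have := h a; rewrite !inE eqxx => /(_ isT); lia.
Qed.

Lemma triangle_sides s : #|s| = 3 -> s \subset itv a k -> s \subset itv k b -> False.
Proof.
move=> s3 /sub_itvP h1 /sub_itvP h2.
(* The two ranges meet only in [k]; the singleton is treated as a degenerate pair. *)
have /subsetPn[m ms] := triangle_not_pair k k s3; rewrite !inE -!val_eqE /=.
by have := h1 m ms; have := h2 m ms; lia.
Qed.

Lemma disjoint_sides : [disjoint T1 & T2].
Proof.
apply/pred0P => s /=; apply/negP => /andP[/tri1[s3 h1] /tri2[_ h2]].
exact: triangle_sides h1 h2.
Qed.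

Lemma card_glue : #|glue a k b T1 T2| = (1 + (#|T1| + #|T2|))%N.
Proof.
have [N1 N2] := apex_notin.
rewrite cardsU1 inE negb_or N1 N2; congr (_ + _)%N.
by apply/eqP; rewrite (leq_card_setU T1 T2).2 disjoint_sides.
Qed.

Lemma inside_glue : (inside a k (glue a k b T1 T2) = T1) /\
  (inside k b (glue a k b T1 T2) = T2).
Proof.
split; apply/setP => s; rewrite !inE; apply/andP/idP.
- case=> /or3P[/eqP->|//|/tri2[s3 h]] h'; last by case: (triangle_sides s3 h' h).
  by have /sub_itvP/(_ b) := h'; rewrite !inE eqxx orbT => /(_ isT); lia.
- by move=> sT; have [_ ->] := tri1 sT; rewrite sT orbT.
- case=> /or3P[/eqP->|/tri1[s3 h]|//] h'; last by case: (triangle_sides s3 h h').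
  by have /sub_itvP/(_ a) := h'; rewrite !inE eqxx => /(_ isT); lia.
- by move=> sT; have [_ ->] := tri2 sT; rewrite sT !orbT.
Qed.

Lemma triangles_glue : triangles_in a b (glue a k b T1 T2).
Proof.
move=> s; rewrite !inE => /or3P[/eqP->|/tri1[-> h]|/tri2[-> h]].
- rewrite card_triangle //; split=> //; apply/sub_itvP => m.
  by rewrite !inE -!val_eqE /=; lia.
- by split=> //; apply: itvW h; lia.
- by split=> //; apply: itvW h; lia.
Qed.

(** Crossing chords have an endpoint of each strictly between the endpoints of the other. None of
    [a], [k], [b] lies strictly inside [a..k] or [k..b], and these ranges share only [k]. *)
Lemma noncrossing_glue : noncrossing T1 -> noncrossing T2 ->
  noncrossing (glue a k b T1 T2).
Proof.
move=> nc1 nc2.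
have triE m : m \in [set a; k; b] -> m = a :> nat \/ m = k :> nat \/ m = b :> nat.
  by rewrite !inE -orbA => /or3P[]/eqP->; auto.
move=> s s'; rewrite !inE => /or3P[/eqP->|sT|sT] /or3P[/eqP->|s'T|s'T].
- by case=> i [j [u [v [/triE i_ /triE j_ /triE u_ /triE v_ h]]]]; lia.
- have [_ /sub_itvP h'] := tri1 s'T.
  by case=> i [j [u [v [/triE i_ /triE j_ /h' u_ /h' v_ h]]]]; lia.
- have [_ /sub_itvP h'] := tri2 s'T.
  by case=> i [j [u [v [/triE i_ /triE j_ /h' u_ /h' v_ h]]]]; lia.
- have [_ /sub_itvP h'] := tri1 sT.
  by case=> i [j [u [v [/h' i_ /h' j_ /triE u_ /triE v_ h]]]]; lia.
- exact: nc1.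
- have [_ /sub_itvP h'] := tri1 sT; have [_ /sub_itvP h''] := tri2 s'T.
  by case=> i [j [u [v [/h' i_ /h' j_ /h'' u_ /h'' v_ h]]]]; lia.
- have [_ /sub_itvP h'] := tri2 sT.
  by case=> i [j [u [v [/h' i_ /h' j_ /triE u_ /triE v_ h]]]]; lia.
- have [_ /sub_itvP h'] := tri2 sT; have [_ /sub_itvP h''] := tri1 s'T.
  by case=> i [j [u [v [/h' i_ /h' j_ /h'' u_ /h'' v_ h]]]]; lia.
- exact: nc2.
Qed.
End Glue.

Lemma dissection_glue a k b T1 T2 : (a < k < b)%N ->
  dissection a k T1 -> dissection k b T2 -> dissection a b (glue a k b T1 T2).
Proof.
move=> akb [t1 nc1 c1] [t2 nc2 c2]; split.
- exact: triangles_glue.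
- exact: noncrossing_glue.
- by rewrite card_glue // c1 c2; lia.
Qed.
End Dissection.

(** * Checkerboard colourings *)

Section Checkerboard.
Context {n : nat}.
Implicit Types (a b i j k m : 'I_n.+2) (s : {set 'I_n.+2}).
Implicit Types (T B : {set {set 'I_n.+2}}).

(** [is_checkerboard] relative to an arbitrary base edge [a b], to allow induction on subpolygons;
    at [ord0] and [ord_max] the two agree by definition. *)
Definition checkerboard a b T B : bool :=
  [&& B \subset T,
      [forall s in T, ([set a; b] \subset s) ==> (s \in B)] &
      [forall s in T, forall s' in T,
         (#|s :&: s'| == 2) ==> ((s \in B) != (s' \in B))]].

Lemma checkerboardP a b T B :
  reflect [/\ B \subset T,
      forall s, s \in T -> [set a; b] \subset s -> s \in B &
      forall s s', s \in T -> s' \in T -> #|s :&: s'| = 2 -> (s \in B) = (s' \notin B)]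
    (checkerboard a b T B).
Proof.
apply: (iffP and3P) => -[BT h1 h2]; split=> //.
- by move=> s sT; apply/implyP; have /forall_inP := h1; apply.
- move=> s s' sT s'T c; have /forall_inP/(_ s sT)/forall_inP/(_ s' s'T) := h2.
  by rewrite c eqxx /=; case: (s \in B); case: (s' \in B).
- by apply/forall_inP => s sT; apply/implyP; apply: h1.
- apply/forall_inP => s sT; apply/forall_inP => s' s'T; apply/implyP => /eqP c.
  by rewrite (h2 s s') //; case: (s' \in B).
Qed.

Lemma card_setI2 (s S : {set 'I_n.+2}) : #|S| = 2 -> (#|s :&: S| == 2) = (S \subset s).
Proof.
move=> cS; apply/eqP/idP => [c|/setIidPr-> //].
have /eqP <- : s :&: S == S by rewrite eqEcard subsetIr c cS.
exact: subsetIl.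
Qed.

(** * Colourings of glued families *)

Section Glue.
Context (a k b : 'I_n.+2) (T1 T2 : {set {set 'I_n.+2}}).
Hypothesis akb : (a < k < b)%N.
Hypotheses (tri1 : triangles_in a k T1) (tri2 : triangles_in k b T2).

(** A triangle on [a..k] can meet the apex triangle only in [a] and [k], so adjacency to the apex
    means lying on the base edge of the left part. *)
Lemma adjacent_left s : s \in T1 ->
  (#|s :&: [set a; k; b]| == 2) = ([set a; k] \subset s).
Proof.
move=> /tri1[_ /sub_itvP h].
rewrite -(card_setI2 s (S := [set a; k])); last first.
  by rewrite cards2 -val_eqE /= (_ : _ == _ = false) //; lia.
congr (#|pred_of_set _| == 2); apply/setP => m; rewrite !inE.
case: (boolP (m \in s)) => //= /h; rewrite -!val_eqE /=; lia.
Qed.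

Lemma adjacent_right s : s \in T2 ->
  (#|s :&: [set a; k; b]| == 2) = ([set k; b] \subset s).
Proof.
move=> /tri2[_ /sub_itvP h].
rewrite -(card_setI2 s (S := [set k; b])); last first.
  by rewrite cards2 -val_eqE /= (_ : _ == _ = false) //; lia.
congr (#|pred_of_set _| == 2); apply/setP => m; rewrite !inE.
case: (boolP (m \in s)) => //= /h; rewrite -!val_eqE /=; lia.
Qed.

Lemma adjacent_across s s' : s \in T1 -> s' \in T2 -> #|s :&: s'| <> 2.
Proof.
move=> /tri1[_ /sub_itvP h] /tri2[_ /sub_itvP h'] c.
have /subset_leq_card : s :&: s' \subset [set k]; last by rewrite c cards1.
apply/subsetP => m; rewrite !inE -val_eqE /= => /andP[/h {}h /h' {}h']; lia.
Qed.

(** The apex is black, so its neighbours on [a k] and [k b] must be white: both parts have their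
    colours exchanged. *)
Lemma checkerboard_glue B1 B2 : checkerboard a k T1 B1 -> checkerboard k b T2 B2 ->
  checkerboard a b (glue a k b T1 T2) (glue a k b (T1 :\: B1) (T2 :\: B2)).
Proof.
move=> /checkerboardP[B1T b1 c1] /checkerboardP[B2T b2 c2].
have [N1 N2] := apex_notin akb tri1 tri2; have /andP[ak kb] := akb.
have D s : s \in T1 -> s \notin T2 by move/(disjointFr (disjoint_sides akb tri1 tri2))->.
have in1 s : s \in T1 -> (s \in glue a k b (T1 :\: B1) (T2 :\: B2)) = (s \notin B1).
  move=> sT; rewrite !inE sT (negPf (D s sT)) andbT andbF orbF.
  by case: eqP => // e; rewrite -e sT in N1.
have in2 s : s \in T2 -> (s \in glue a k b (T1 :\: B1) (T2 :\: B2)) = (s \notin B2).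
  move=> sT; rewrite !inE sT andbT; have /negPf -> : s \notin T1.
    by apply/negP => /D; rewrite sT.
  by rewrite andbF; case: eqP => // e; rewrite -e sT in N2.
have in0 : [set a; k; b] \in glue a k b (T1 :\: B1) (T2 :\: B2) by rewrite !inE eqxx.
apply/checkerboardP; split.
- by apply: setUS; apply: setUSS; apply: subsetDl.
- move=> s /setU1P[-> //|/setUP[]sT] /subsetP h.
    have [_ /sub_itvP/(_ b)] := tri1 sT.
    by rewrite h ?inE ?eqxx ?orbT // (leqNgt b k) kb andbF => /(_ isT).
  have [_ /sub_itvP/(_ a)] := tri2 sT.
  by rewrite h ?inE ?eqxx // (leqNgt k a) ak => /(_ isT).
move=> s s' /setU1P[->|/setUP[]sT] /setU1P[->|/setUP[]s'T].
- by rewrite setIid card_triangle.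
- rewrite setIC => /eqP; rewrite adjacent_left // => h.
  by rewrite in0 in1 // negbK b1.
- rewrite setIC => /eqP; rewrite adjacent_right // => h.
  by rewrite in0 in2 // negbK b2.
- by move=> /eqP; rewrite adjacent_left // => h; rewrite in0 in1 // b1.
- by move=> c; rewrite !in1 // (c1 s s').
- by move=> /(adjacent_across sT s'T).
- by move=> /eqP; rewrite adjacent_right // => h; rewrite in0 in2 // b2.
- by rewrite setIC => /(adjacent_across s'T sT).
- by move=> c; rewrite !in2 // (c2 s s').
Qed.

Lemma checkerboard_split B : checkerboard a b (glue a k b T1 T2) B ->
  [/\ [set a; k; b] \in B, checkerboard a k T1 (T1 :\: B)
    & checkerboard k b T2 (T2 :\: B)].
Proof.
move=> /checkerboardP[BT bB cB].
have in0 : [set a; k; b] \in glue a k b T1 T2 by rewrite !inE eqxx.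
have in1 s : s \in T1 -> s \in glue a k b T1 T2 by rewrite !inE => ->; rewrite orbT.
have in2 s : s \in T2 -> s \in glue a k b T1 T2 by rewrite !inE => ->; rewrite !orbT.
have aB : [set a; k; b] \in B.
  apply: bB => //; apply/subsetP => m; rewrite !inE => /orP[]->; rewrite ?orbT //.
split=> //; apply/checkerboardP; split; rewrite ?subsetDl //.
- move=> s sT; rewrite -adjacent_left // inE sT andbT => /eqP c.
  by rewrite (cB s [set a; k; b]) ?aB // in1.
- by move=> s s' sT s'T c; rewrite !inE sT s'T !andbT (cB s s') ?in1.
- move=> s sT; rewrite -adjacent_right // inE sT andbT => /eqP c.
  by rewrite (cB s [set a; k; b]) ?aB // in2.
- by move=> s s' sT s'T c; rewrite !inE sT s'T !andbT (cB s s') ?in2.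
Qed.
End Glue.

(** By induction the two colourings have the same white triangles on each side of the apex, hence
    the same black ones. *)
Lemma checkerboard_uniq a b T B B' : (a < b)%N -> dissection a b T ->
  checkerboard a b T B -> checkerboard a b T B' -> B = B'.
Proof.
have [d] := ubnP (b - a)%N; elim: d => // d IH in a b T B B' *.
move=> abd ab dT; have [ab1|ab1] := leqP b a.+1.
  have /(dissection_edge T)/iffLR/(_ dT)-> : b = a.+1 :> nat by lia.
  move=> /checkerboardP[+ _ _] /checkerboardP[+ _ _].
  by rewrite !subset0 => /eqP-> /eqP->.
have [k akb akbT] := dissection_apex ab1 dT.
have [d1 d2 E] := dissection_split akb dT akbT; rewrite {1 2}E.
have [[t1 _ _] [t2 _ _]] := (d1, d2).
move=> cB cB'; have [aB c1 c2] := checkerboard_split akb t1 t2 cB.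
have [aB' c1' c2'] := checkerboard_split akb t1 t2 cB'.
have /andP[ak kb] := akb.
have ad : (k - a < d)%N /\ (b - k < d)%N by move: abd; clear -ak kb; lia.
have E1 := IH a k _ _ _ ad.1 ak d1 c1 c1'; have E2 := IH k b _ _ _ ad.2 kb d2 c2 c2'.
have [/checkerboardP[/subsetP BT _ _] /checkerboardP[/subsetP B'T _ _]] := (cB, cB').
apply/setP => s.
case: (boolP (s \in glue a k b (inside a k T) (inside k b T))); last first.
  by move=> sN; rewrite (contraNF (BT s) sN) (contraNF (B'T s) sN).
move=> /setU1P[->|/setUP[] sT]; first by rewrite aB aB'.
  by move/setP/(_ s): E1; rewrite !(in_setD, sT) !andbT => /negb_inj.
by move/setP/(_ s): E2; rewrite !(in_setD, sT) !andbT => /negb_inj.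
Qed.

Lemma checkerboard_exists a b T : (a < b)%N -> dissection a b T ->
  exists B, checkerboard a b T B.
Proof.
have [d] := ubnP (b - a)%N; elim: d => // d IH in a b T *.
move=> abd ab dT; have [ab1|ab1] := leqP b a.+1.
  have /(dissection_edge T)/iffLR/(_ dT)-> : b = a.+1 :> nat by lia.
  by exists set0; apply/checkerboardP; split=> [|s|s s']; rewrite ?sub0set ?inE.
have [k akb akbT] := dissection_apex ab1 dT.
have [d1 d2 E] := dissection_split akb dT akbT; rewrite E.
have [[t1 _ _] [t2 _ _]] := (d1, d2).
have /andP[ak kb] := akb.
have ad : (k - a < d)%N /\ (b - k < d)%N by move: abd; clear -ak kb; lia.
have [B1 c1] := IH a k _ ad.1 ak d1; have [B2 c2] := IH k b _ ad.2 kb d2.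
by eexists; apply: checkerboard_glue c1 c2.
Qed.

(** * Weights of dissections and their recurrence *)

Definition black_between a b T : {set {set 'I_n.+2}} :=
  odflt set0 [pick B | checkerboard a b T B].

Lemma black_betweenP a b T : (a < b)%N -> dissection a b T ->
  checkerboard a b T (black_between a b T).
Proof.
move=> ab dT; have [B cB] := checkerboard_exists ab dT.
by rewrite /black_between; case: pickP => // /(_ B); rewrite cB.
Qed.

Definition weight a b T : laurent :=
  texp (#|black_between a b T|%:Z - #|T :\: black_between a b T|%:Z).

(** Exchanging the colours in both parts negates their exponents, and the apex contributes one more
    black triangle. *)
Lemma weight_glue a k b T1 T2 : (a < k < b)%N ->
    dissection a k T1 -> dissection k b T2 ->
  weight a b (glue a k b T1 T2) = texp 1 * (tinv (weight a k T1) * tinv (weight k b T2)).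
Proof.
move=> akb d1 d2; have /andP[ak kb] := akb.
have [[t1 _ _] [t2 _ _]] := (d1, d2).
have c1 := black_betweenP ak d1; have c2 := black_betweenP kb d2.
have d := dissection_glue akb d1 d2; rewrite /weight.
have -> : black_between a b (glue a k b T1 T2) =
    glue a k b (T1 :\: black_between a k T1) (T2 :\: black_between k b T2).
  have cT := black_betweenP (ltn_trans ak kb) d.
  exact: checkerboard_uniq (ltn_trans ak kb) d cT (checkerboard_glue akb t1 t2 c1 c2).
have tW i j T B : triangles_in i j T -> triangles_in i j (T :\: B).
  by move=> tT s; rewrite inE => /andP[_ /tT].
(* White triangles are counted through the total, which turns the comparison of exponents into
   linear arithmetic. *)
have cD i j T B : checkerboard i j T B -> (#|B| + #|T :\: B|)%N = #|T|.
  by case/checkerboardP => BT _ _; rewrite -(cardsID B T) (setIidPr BT).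
have := cD _ _ _ _ (checkerboard_glue akb t1 t2 c1 c2).
rewrite !card_glue // -?(cD _ _ _ _ c1) -?(cD _ _ _ _ c2); do ?exact: tW.
rewrite !tinvU -!texpD => h; congr texp; lia.
Qed.

Definition dissection_sum a b : laurent :=
  \sum_(T : {set {set 'I_n.+2}} | `[< dissection a b T >]) weight a b T.

Lemma dissection_sum_edge a b : b = a.+1 :> nat -> dissection_sum a b = 1.
Proof.
move=> ab; rewrite /dissection_sum (big_pred1 set0) => [|T]; last first.
  by apply/asboolP/eqP; rewrite dissection_edge.
have /checkerboardP[] : checkerboard a b set0 (black_between a b set0).
  by apply: black_betweenP; [lia | apply/dissection_edge].
by rewrite subset0 /weight => /eqP-> _ _; rewrite set0D cards0.
Qed.

(** Dissections are grouped by the apex [k] of the triangle on the base edge. *)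
Lemma dissection_sum_rec a b : (a.+1 < b)%N ->
  dissection_sum a b = texp 1 * \sum_(k : 'I_n.+2 | (a < k < b)%N)
    tinv (dissection_sum a k) * tinv (dissection_sum k b).
Proof.
move=> ab.
(* The default [a] is never taken on a dissection, by [dissection_apex]. *)
pose apex T := odflt a [pick k : 'I_n.+2 | (a < k < b)%N && ([set a; k; b] \in T)].
have apexP T : dissection a b T -> (a < apex T < b)%N /\ [set a; apex T; b] \in T.
  move=> dT; rewrite /apex; case: pickP => [k /andP[] //|h].
  by have [k akb kT] := dissection_apex ab dT; move: (h k); rewrite akb kT.
rewrite /dissection_sum.
rewrite (partition_big apex (fun k : 'I_n.+2 => (a < k < b)%N)) /=; last first.
  by move=> T /asboolP/apexP[].
rewrite mulr_sumr; apply: eq_bigr => k akb.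
(* For a fixed apex, gluing and restriction to the two sides are inverse bijections. *)
rewrite (reindex_onto (fun q => glue a k b q.1 q.2)
  (fun T => (inside a k T, inside k b T))) /=; last first.
  move=> T /andP[/asboolP dT /eqP kE]; have [_ kT] := apexP T dT; rewrite kE in kT.
  by have [_ _ <-] := dissection_split akb dT kT.
rewrite !tinv_sum mulr_suml; under [in RHS]eq_bigr => T1 _ do rewrite mulr_sumr.
rewrite pair_big /= mulr_sumr; apply: eq_big => [[T1 T2]|[T1 T2]] /=.
  apply/andP/andP => [[/andP[/asboolP dT /eqP kE] /eqP[E1 E2]]|[/asboolP d1 /asboolP d2]].
    have [_ kT] := apexP _ dT; rewrite kE in kT.
    have [] := dissection_split akb dT kT; rewrite E1 E2 => d1 d2 _.
    by split; apply/asboolP.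
  have d := dissection_glue akb d1 d2; have [[t1 _ _] [t2 _ _]] := (d1, d2).
  have [E1 E2] := inside_glue akb t1 t2; rewrite E1 E2 eqxx; split=> //.
  have [akb' kT] := apexP _ d; apply/andP; split; first exact/asboolP.
  by apply/eqP; apply: dissection_apex_uniq d akb' akb kT _; rewrite !inE eqxx.
move=> /andP[/andP[/asboolP dT /eqP kE] /eqP[E1 E2]].
have [_ kT] := apexP _ dT; rewrite kE in kT.
have [] := dissection_split akb dT kT; rewrite E1 E2 => d1 d2 _.
exact: weight_glue.
Qed.
End Checkerboard.

(** * Plane geometry *)

Section Plane.
Context {R : realFieldType}.
Implicit Types u v x a b c : 'rV[R]_2.

Lemma rV2P u v : u 0 0 = v 0 0 -> u 0 1 = v 0 1 -> u = v.
Proof.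
move=> e0 e1; apply/rowP => i.
case: (unliftP 0 i) => [j ->|-> //].
by rewrite (ord1 j) (_ : lift 0 0 = 1) //; apply/val_inj.
Qed.

Lemma orient_rot a b c : orient a b c = orient b c a.
Proof. by rewrite /orient; ring. Qed.

Lemma orient_swap a b c : orient b a c = - orient a b c.
Proof. by rewrite /orient; ring. Qed.

Lemma orient_l a b : orient a b a = 0.
Proof. by rewrite /orient; ring. Qed.

Lemma orient_r a b : orient a b b = 0.
Proof. by rewrite /orient; ring. Qed.

(** Cramer's rule: barycentric coordinates are ratios of signed areas. *)
Lemma barycentric a b c x : orient a b c != 0 ->
  [/\ orient b c x / orient a b c + orient c a x / orient a b c
        + orient a b x / orient a b c = 1
    & x = (orient b c x / orient a b c) *: a + (orient c a x / orient a b c) *: b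
        + (orient a b x / orient a b c) *: c].
Proof.
move=> D0; split.
  by rewrite -!mulrDl -[RHS](divff D0); congr (_ / _); rewrite /orient; ring.
apply: rV2P; rewrite !mxE; move: D0; rewrite /orient => D0; field; exact: D0.
Qed.

Lemma pos_perturb (l m : R) : 0 < l ->
  exists2 d, 0 < d & forall e, 0 < e -> e <= d -> 0 < l + e * m.
Proof.
(* The [+ 1] avoids a zero denominator and makes the final inequality strict. *)
move=> l0; exists (l / (`|m| + 1)) => [|e e0 ed].
  by rewrite divr_gt0 // ltr_wpDl.
have m1 : 0 < `|m| + 1 by rewrite ltr_wpDl.
have : e * (`|m| + 1) <= l by rewrite -ler_pdivlMr.
have : - (e * `|m|) <= e * m.
  by rewrite -mulrN ler_pM2l // lerNl -normrN ler_norm.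
by rewrite mulrDr mulr1; lra.
Qed.
End Plane.

(** * Hulls of vertex sets and half-planes *)

Section Polygon.
Context {R : realFieldType} {n : nat} (p : 'I_n.+2 -> 'rV[R]_2).
Implicit Types (S s : {set 'I_n.+2}) (i j k : 'I_n.+2) (x : 'rV[R]_2).

(** The signed area is affine in its third argument, so it commutes with combinations of total
    weight 1. *)
Lemma orient_sum S (l : 'I_n.+2 -> R) u v : \sum_(i in S) l i = 1 ->
  orient u v (\sum_(i in S) l i *: p i) = \sum_(i in S) l i * orient u v (p i).
Proof.
move=> l1.
have E x : orient u v x =
    (v 0 0 - u 0 0) * x 0 1 - (v 0 1 - u 0 1) * x 0 0 + orient u v 0.
  by rewrite /orient !mxE; ring.
rewrite E (eq_bigr (fun i => l i * ((v 0 0 - u 0 0) * p i 0 1)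
  - l i * ((v 0 1 - u 0 1) * p i 0 0) + l i * orient u v 0)); last first.
  by move=> i _; rewrite E mulrDr mulrBr.
rewrite big_split sumrB /= -mulr_suml l1 mul1r; congr (_ - _ + _).
  by rewrite summxE mulr_sumr; apply: eq_bigr => i _; rewrite mxE mulrCA.
by rewrite summxE mulr_sumr; apply: eq_bigr => i _; rewrite mxE mulrCA.
Qed.

Lemma hullW S s x : s \subset S -> hull p s x -> hull p S x.
Proof.
move=> sS [l [l0 l1 ->]]; exists (fun i => if i \in s then l i else 0).
have sub (V : nmodType) (F : 'I_n.+2 -> V) :
    (forall i, i \notin s -> F i = 0) -> \sum_(i in S) F i = \sum_(i in s) F i.
  move=> F0; rewrite (big_setID s) /= (setIidPr sS) [X in _ + X]big1 ?addr0 //.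
  by move=> i /setDP[_ /F0].
split=> [i _||]; first by case: ifP => // /l0.
  by rewrite sub => [|i /negPf-> //]; rewrite -l1; apply: eq_bigr => i ->.
rewrite sub => [|i /negPf-> //]; last by rewrite scale0r.
by apply: eq_bigr => i ->.
Qed.

Lemma hull_orient_ge0 S u v x : (forall i, i \in S -> 0 <= orient u v (p i)) ->
  hull p S x -> 0 <= orient u v x.
Proof.
move=> S0 [l [l0 l1 ->]]; rewrite orient_sum //.
by apply: sumr_ge0 => i iS; rewrite mulr_ge0 ?l0 ?S0.
Qed.

Lemma hull_interiorW S x : hull_interior p S x -> hull p S x.
Proof. by case=> l [l0 l1 ->]; exists l; split=> // i /l0/ltW. Qed.

Lemma hull_interior_orient_gt0 S u v x i :
    (forall i, i \in S -> 0 <= orient u v (p i)) ->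
    i \in S -> 0 < orient u v (p i) ->
  hull_interior p S x -> 0 < orient u v x.
Proof.
move=> S0 iS i0 [l [l0 l1 ->]]; rewrite orient_sum // (big_setD1 i) //=.
rewrite ltr_wpDr ?mulr_gt0 ?l0 //.
by apply: sumr_ge0 => j /setD1P[_ jS]; rewrite mulr_ge0 ?S0 // ltW ?l0.
Qed.

Section Triangle.
Context (i j k : 'I_n.+2).
Hypotheses (ij : i != j) (jk : j != k) (ki : k != i).
Hypothesis D0 : orient (p i) (p j) (p k) != 0.

Lemma sum_triangle (V : nmodType) (F : 'I_n.+2 -> V) :
  \sum_(m in [set i; j; k]) F m = F i + F j + F k.
Proof.
rewrite setUC big_setU1 ?big_setU1 ?big_set1 ?inE //=; last first.
  by rewrite negb_or ki eq_sym jk.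
by rewrite addrC.
Qed.

(** Barycentric coordinates as a function on all indices; the last branch serves [k], and its values
    elsewhere are immaterial since sums run over the triangle. *)
Definition tri_weight x : 'I_n.+2 -> R := fun m =>
  (if m == i then orient (p j) (p k) x else
   if m == j then orient (p k) (p i) x else orient (p i) (p j) x)
  / orient (p i) (p j) (p k).

Lemma tri_weightE x :
  [/\ tri_weight x i = orient (p j) (p k) x / orient (p i) (p j) (p k),
      tri_weight x j = orient (p k) (p i) x / orient (p i) (p j) (p k)
    & tri_weight x k = orient (p i) (p j) x / orient (p i) (p j) (p k)].
Proof.
rewrite /tri_weight eqxx [j == i]eq_sym (negPf ij) eqxx (negPf ki).
by rewrite [k == j]eq_sym (negPf jk).
Qed.

Lemma tri_weight_sum x : \sum_(m in [set i; j; k]) tri_weight x m = 1.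
Proof.
by rewrite sum_triangle; have [-> -> ->] := tri_weightE x; case: (barycentric x D0).
Qed.

Lemma tri_weight_comb x : x = \sum_(m in [set i; j; k]) tri_weight x m *: p m.
Proof.
by rewrite sum_triangle; have [-> -> ->] := tri_weightE x; case: (barycentric x D0).
Qed.

(** Division by the signed area makes the criterion valid for either orientation of the triangle. *)
Lemma hull_triangle x :
    0 <= orient (p j) (p k) x / orient (p i) (p j) (p k) ->
    0 <= orient (p k) (p i) x / orient (p i) (p j) (p k) ->
    0 <= orient (p i) (p j) x / orient (p i) (p j) (p k) ->
  hull p [set i; j; k] x.
Proof.
move=> h1 h2 h3; exists (tri_weight x); split; last exact: tri_weight_comb.
  by have [E1 E2 E3] := tri_weightE x => m; rewrite !inE -orbA
    => /or3P[]/eqP->; rewrite ?E1 ?E2 ?E3.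
exact: tri_weight_sum.
Qed.

Lemma hull_interior_triangle x :
    0 < orient (p j) (p k) x / orient (p i) (p j) (p k) ->
    0 < orient (p k) (p i) x / orient (p i) (p j) (p k) ->
    0 < orient (p i) (p j) x / orient (p i) (p j) (p k) ->
  hull_interior p [set i; j; k] x.
Proof.
move=> h1 h2 h3; exists (tri_weight x); split; last exact: tri_weight_comb.
  by have [E1 E2 E3] := tri_weightE x => m; rewrite !inE -orbA
    => /or3P[]/eqP->; rewrite ?E1 ?E2 ?E3.
exact: tri_weight_sum.
Qed.
End Triangle.
End Polygon.

(** * Overlap of triangles with crossing sides *)

Section Crossing.
Context {R : realFieldType}.
Implicit Types u v x a b c q w : 'rV[R]_2.

(** From a point [q] inside the side [a b], a short move along a vector [w] pointing to the side of
    [c] enters the triangle. *)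
Lemma side_interior a b c q w (l : R) :
    orient a b c != 0 -> 0 < l < 1 -> q = l *: a + (1 - l) *: b ->
    0 < orient a b (a + w) / orient a b c ->
  exists2 d, 0 < d & forall e, 0 < e -> e <= d ->
    [/\ 0 < orient b c (q + e *: w) / orient a b c,
        0 < orient c a (q + e *: w) / orient a b c
      & 0 < orient a b (q + e *: w) / orient a b c].
Proof.
move=> D0 /andP[l0 l1] -> w0.
have l1' : 0 < 1 - l by rewrite subr_gt0.
(* At [q] the coordinates of [a] and [b] are [l] and [1 - l]; the given ratios are their rates of
   change along [w]. *)
have [d1 d10 d1P] := pos_perturb (orient b c (b + w) / orient a b c) l0.
have [d2 d20 d2P] := pos_perturb (orient c a (a + w) / orient a b c) l1'.
exists (Num.min d1 d2) => [|e e0]; first by rewrite lt_min d10.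
rewrite le_min => /andP[/(d1P _ e0) h1 /(d2P _ e0) h2].
split.
- apply: etrans h1; congr (0 < _); move: D0; rewrite /orient !mxE => D0; field; exact: D0.
- apply: etrans h2; congr (0 < _); move: D0; rewrite /orient !mxE => D0; field; exact: D0.
- have := mulr_gt0 e0 w0; apply: etrans; congr (0 < _).
  by rewrite mulrA; congr (_ / _); rewrite /orient !mxE; ring.
Qed.

Lemma crossing_triangles a b c u v w :
    0 < orient u v a -> orient u v b < 0 -> orient a b u < 0 -> 0 < orient a b v ->
    orient a b c != 0 -> orient u v w != 0 ->
  exists x,
    [/\ 0 < orient b c x / orient a b c, 0 < orient c a x / orient a b c
      & 0 < orient a b x / orient a b c] /\
    [/\ 0 < orient v w x / orient u v w, 0 < orient w u x / orient u v w
      & 0 < orient u v x / orient u v w].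
Proof.
move=> ua ub au av D0 D'0.
have uab : orient u v a - orient u v b != 0 by rewrite gt_eqF // subr_gt0 (lt_trans ub).
have auv : orient a b v - orient a b u != 0 by rewrite gt_eqF // subr_gt0 (lt_trans au).
(* These weights make [orient u v] vanish on the segment [a b], and [orient a b] on the segment
   [u v]: both describe the intersection point. *)
pose l := - orient u v b / (orient u v a - orient u v b).
pose m := orient a b v / (orient a b v - orient a b u).
have l01 : 0 < l < 1.
  rewrite /l ltr_pdivlMr ?ltr_pdivrMr ?subr_gt0 ?(lt_trans ub ua) //.
  by apply/andP; split; lra.
have m01 : 0 < m < 1.
  rewrite /m ltr_pdivlMr ?ltr_pdivrMr ?subr_gt0 ?(lt_trans au av) //.
  by apply/andP; split; lra.
pose q := l *: a + (1 - l) *: b.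
have qE : q = m *: u + (1 - m) *: v.
  by apply: rV2P; rewrite /q /l /m !mxE; move: uab auv; rewrite /orient => uab auv; field.
(* Moving from the intersection point of the two segments along both of them,
   towards the side of the opposite vertex, enters both triangles. *)
pose e := (orient u v w * (orient u v b - orient u v a)) *: (b - a).
pose f := (orient a b c * (orient a b v - orient a b u)) *: (v - u).
(* [e] is parallel to [a b], so only [f] counts, and its scalar turns the ratio into a nonzero
   square. *)
have aef : 0 < orient a b (a + (e + f)) / orient a b c.
  suff -> : orient a b (a + (e + f)) / orient a b c = (orient a b v - orient a b u) ^+ 2.
    by rewrite exprn_even_gt0.
  apply: (mulIf D0); rewrite divfK // /e /f /orient !mxE; ring.
have uef : 0 < orient u v (u + (e + f)) / orient u v w.
  suff -> : orient u v (u + (e + f)) / orient u v w = (orient u v b - orient u v a) ^+ 2.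
    by rewrite exprn_even_gt0 //= -oppr_eq0 opprB.
  apply: (mulIf D'0); rewrite divfK // /e /f /orient !mxE; ring.
have [d1 d10 h1] := side_interior D0 l01 (erefl q) aef.
have [d2 d20 h2] := side_interior D'0 m01 qE uef.
have d0 : 0 < Num.min d1 d2 by rewrite lt_min d10.
exists (q + Num.min d1 d2 *: (e + f)).
by split; [apply: h1 | apply: h2]; rewrite ?ge_min ?lexx ?orbT.
Qed.
End Crossing.

(** * Triangulations of a strictly convex polygon as dissections *)

Section ConvexPolygon.
Context {R : realFieldType} {n : nat} (p : 'I_n.+2 -> 'rV[R]_2).
Hypothesis hp : strictly_convex p.
Implicit Types (a b i j k m u v : 'I_n.+2) (s : {set 'I_n.+2}).
Implicit Types (T : {set {set 'I_n.+2}}) (x : 'rV[R]_2).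

Lemma orient_outside i j m : (i < j)%N -> (m < i)%N || (j < m)%N ->
  0 < orient (p i) (p j) (p m).
Proof. by move=> ij /orP[mi|jm]; [rewrite -orient_rot; apply: hp | apply: hp]. Qed.

Lemma orient_between i j m : (i < m < j)%N -> 0 < orient (p j) (p i) (p m).
Proof. by case/andP=> im mj; rewrite orient_rot; apply: hp. Qed.

Lemma orient_outside_ge0 i j m : (i < j)%N -> ~~ (i < m < j)%N ->
  0 <= orient (p i) (p j) (p m).
Proof.
move=> ij; have [->|mi] := eqVneq m i; first by rewrite orient_l.
have [->|mj] := eqVneq m j; first by rewrite orient_r.
move=> mN; apply/ltW/orient_outside => //; move: mi mj mN; rewrite -!val_eqE /=; lia.
Qed.

Lemma orient_between_ge0 i j m : (i <= m <= j)%N -> 0 <= orient (p j) (p i) (p m).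
Proof.
have [->|mi] := eqVneq m i; first by rewrite orient_r.
have [->|mj] := eqVneq m j; first by rewrite orient_l.
move=> imj; apply/ltW/orient_between; move: mi mj imj; rewrite -!val_eqE /=; lia.
Qed.

Lemma orient_neq0 i j m : (i < j)%N -> m != i -> m != j ->
  orient (p i) (p j) (p m) != 0.
Proof.
move=> ij mi mj; have [h|h] := boolP ((m < i)%N || (j < m)%N).
  by rewrite gt_eqF // orient_outside.
have /orient_between : (i < m < j)%N by move: mi mj h; rewrite -!val_eqE /=; lia.
by rewrite orient_swap oppr_gt0 => /lt_eqF->.
Qed.

Lemma third_vertex s i j : #|s| = 3 -> i \in s -> j \in s -> i != j ->
  exists2 k : 'I_n.+2, (k != i) && (k != j) & s = [set i; j; k].
Proof.
move=> s3 is_ js ij; have /subsetPn[k ks] := triangle_not_pair i j s3.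
rewrite !inE negb_or => kij; exists k => //.
apply/esym/eqP; rewrite eqEcard s3 setUC cardsU1 cards2 ij !inE negb_or kij andbT.
by apply/subsetP => m; rewrite !inE => /or3P[]/eqP->.
Qed.

(** By convexity the interleaved chords have endpoints on opposite sides of each other, as
    [crossing_triangles] demands. *)
Lemma crossing_interior s s' : #|s| = 3 -> #|s'| = 3 -> crossing s s' ->
  exists x, hull_interior p s x /\ hull_interior p s' x.
Proof.
move=> s3 s'3 [i [j [u [v [is_ js us vs /andP[iu /andP[uj jv]]]]]]].
have ij : i != j by rewrite neq_ltn (ltn_trans iu).
have uv : u != v by rewrite neq_ltn (ltn_trans uj).
have [c /andP[ci cj] ->] := third_vertex s3 is_ js ij.
have [d /andP[du dv] ->] := third_vertex s'3 us vs uv.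
have D := orient_neq0 (ltn_trans iu uj) ci cj.
have D' := orient_neq0 (ltn_trans uj jv) du dv.
have [||||x [[h1 h2 h3] [h4 h5 h6]]] := crossing_triangles _ _ _ _ D D'.
- by rewrite orient_outside ?iu ?(ltn_trans uj).
- by rewrite -oppr_gt0 -orient_swap orient_between // uj.
- by rewrite -oppr_gt0 -orient_swap orient_between // iu.
- by rewrite orient_outside ?jv ?orbT ?(ltn_trans iu).
by exists x; split; apply: hull_interior_triangle; rewrite // eq_sym.
Qed.

(** The line through [i] and [j] weakly separates the triangles; the vertex [u] off the line makes
    the inequality strict inside [s']. *)
Lemma chord_separates i j u s s' x : s' \subset itv i j -> u \in s' -> (i < u < j)%N ->
    (forall m, m \in s -> ~~ (i < m < j)%N) ->
  ~ (hull_interior p s x /\ hull_interior p s' x).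
Proof.
move=> /sub_itvP s'ij us' iuj sN [sx s'x].
have : 0 < orient (p j) (p i) x.
  apply: (hull_interior_orient_gt0 _ us') s'x; last exact: orient_between.
  by move=> m /s'ij; apply: orient_between_ge0.
rewrite orient_swap oppr_gt0 ltNge; apply/negP/negPn.
apply: hull_orient_ge0 (hull_interiorW sx) => m /sN; apply: orient_outside_ge0; lia.
Qed.

(** A vertex [u] of [s'] outside [s] lies beyond one side of [s], and that side separates the two
    triangles. *)
Lemma noncrossing_interior s s' x : #|s| = 3 -> #|s'| = 3 -> s != s' ->
    ~ crossing s s' -> ~ crossing s' s ->
  ~ (hull_interior p s x /\ hull_interior p s' x).
Proof.
move=> s3 s'3 ss' c c'.
have /subsetPn[u us' us] : ~~ (s' \subset s).
  by apply: contraNN ss' => s's; rewrite eq_sym eqEcard s's s3 s'3.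
have [i [j [k [ijk sE]]]] := card3_sorted s3.
have is_ : i \in s by rewrite sE !inE eqxx.
have js : j \in s by rewrite sE !inE eqxx orbT.
have ks : k \in s by rewrite sE !inE eqxx orbT.
have sP m : m \in s -> m = i :> nat \/ m = j :> nat \/ m = k :> nat.
  by rewrite sE !inE -orbA => /or3P[]/eqP->; auto.
have uP : u != i :> nat /\ u != j :> nat /\ u != k :> nat.
  by split; last split; apply: contraNN us => /eqP/val_inj->.
have [uij|uij] := boolP (i < u < j)%N.
  have [s'ij|/(_ u us')] := chord_split is_ js c c'; last by rewrite uij.
  by apply: chord_separates s'ij us' uij _ => m /sP; clear -ijk; lia.
have [ujk|ujk] := boolP (j < u < k)%N.
  have [s'jk|/(_ u us')] := chord_split js ks c c'; last by rewrite ujk.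
  by apply: chord_separates s'jk us' ujk _ => m /sP; clear -ijk; lia.
(* Now [u] lies outside [i..k]: the roles are exchanged, with [s] inside the range and [j] as its
   strict vertex. *)
have [/sub_itvP/(_ u us') uik|s'N] := chord_split is_ ks c c'.
  by exfalso; clear -uij ujk uik uP; lia.
have sik : s \subset itv i k by apply/sub_itvP => m /sP; clear -ijk; lia.
by move=> [sx s'x]; apply: (chord_separates sik js ijk s'N (conj s'x sx)).
Qed.

(** A point beyond the side [a k] or [k b] of the apex triangle belongs to the corresponding
    subpolygon; otherwise it is in the apex triangle. Half-plane conditions pass to a subpolygon
    with only its base edge left to check. *)
Lemma dissection_cover a b T x : (a.+1 < b)%N -> dissection a b T ->
    (forall i j, (a <= i)%N -> j = i.+1 :> nat -> (j <= b)%N ->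
       0 <= orient (p i) (p j) x) ->
    0 <= orient (p b) (p a) x ->
  exists2 s, s \in T & hull p s x.
Proof.
have [d] := ubnP (b - a)%N; elim: d => // d IH in a b T *.
move=> abd ab dT edges base; have [k akb akbT] := dissection_apex ab dT.
have [d1 d2 _] := dissection_split akb dT akbT; have /andP[ak kb] := akb.
have [ax|ax] := ltP (orient (p a) (p k) x) 0.
  have ak1 : (a.+1 < k)%N.
    rewrite ltn_neqAle ak andbT; apply: contraTneq ax => ak1.
    by rewrite -leNgt edges // ltnW.
  have [|i j ai ij jk||s] := IH a k _ _ ak1 d1.
  - by move: abd; clear -ak kb; lia.
  - by apply: edges => //; apply: leq_trans jk (ltnW kb).
  - by rewrite orient_swap oppr_ge0 ltW.
  by rewrite inE => /andP[sT _] sx; exists s.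
have [kx|kx] := ltP (orient (p k) (p b) x) 0.
  have kb1 : (k.+1 < b)%N.
    rewrite ltn_neqAle kb andbT; apply: contraTneq kx => kb1.
    by rewrite -leNgt edges // ltnW.
  have [|i j ki ij jb||s] := IH k b _ _ kb1 d2.
  - by move: abd; clear -ak kb; lia.
  - by apply: edges => //; apply: leq_trans (ltnW ak) ki.
  - by rewrite orient_swap oppr_ge0 ltW.
  by rewrite inE => /andP[sT _] sx; exists s.
have D : 0 < orient (p a) (p k) (p b) by apply: hp.
exists [set a; k; b] => //; apply: hull_triangle; rewrite ?divr_ge0 ?(ltW D) //.
- by rewrite -val_eqE /= neq_ltn ak.
- by rewrite -val_eqE /= neq_ltn kb.
- by rewrite -val_eqE /= neq_ltn (ltn_trans ak kb) orbT.
- by rewrite gt_eqF.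
Qed.

Lemma itv_full : itv ord0 ord_max = [set: 'I_n.+2].
Proof. by apply/setP => i; rewrite !inE /= -ltnS ltn_ord. Qed.

(** Disjointness of interiors corresponds to noncrossing, and a noncrossing family of the right size
    covers the polygon by [dissection_cover]. *)
Lemma triangulation_dissection T : (0 < n)%N ->
  is_triangulation p T <-> dissection ord0 ord_max T.
Proof.
move=> n0; split=> [[T3 cT disj _]|dT].
  split=> [s sT||]; [by rewrite T3 // itv_full subsetT | | by rewrite cT].
  move=> s s' sT s'T c; have [ss'|ss'] := eqVneq s s'; last first.
    have [x sx] := crossing_interior (T3 s sT) (T3 s' s'T) c.
    exact: disj sT s'T ss' x sx.
  (* A triangle cannot cross itself, as a crossing involves four distinct vertices. *)
  have [i [j [k [ijk sE]]]] := card3_sorted (T3 s sT).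
  have sP m : m \in s -> m = i :> nat \/ m = j :> nat \/ m = k :> nat.
    by rewrite sE !inE -orbA => /or3P[]/eqP->; auto.
  case: c; rewrite -ss' => a [b [u [v [/sP a_ /sP b_ /sP u_ /sP v_ h]]]].
  by clear -ijk a_ b_ u_ v_ h; lia.
have [Ttri ncT cT] := dT; split=> [s /Ttri[]//||s s' sT s'T ss' x|x].
- by rewrite cT.
- have [[s3 _] [s'3 _]] := (Ttri _ sT, Ttri _ s'T).
  by apply: noncrossing_interior => //; apply: ncT.
split=> [hx|[s sT]]; last by apply: hullW; apply: subsetT.
apply: dissection_cover dT _ _ => //=.
  move=> i j _ ij _; apply: hull_orient_ge0 hx => m _.
  by apply: orient_outside_ge0; rewrite ij //; clear; lia.
apply: hull_orient_ge0 hx => m _; apply: orient_between_ge0.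
by rewrite /= -ltnS ltn_ord.
Qed.

Lemma wpoly_dissection_sum : (0 < n)%N ->
  wpoly p = dissection_sum (ord0 : 'I_n.+2) ord_max.
Proof.
move=> n0; transitivity (\sum_(T : {set {set 'I_n.+2}} | `[< is_triangulation p T >])
    texp ((nb T)%:Z - (nw T)%:Z)).
  by move: n0 p hp; rewrite /wpoly; case: n.
(* The summands agree by unfolding [weight] at [ord0] and [ord_max]. *)
apply: eq_bigl => T; apply/asboolP/asboolP; by apply triangulation_dissection.
Qed.
End ConvexPolygon.

(** * The recurrence *)

(** The hypothesis is bounded by [m] so that this serves as the step of the strong induction showing
    that [dissection_sum a b] depends only on [b - a]. *)
Lemma dissection_sum_conv (w : nat -> laurent) (m : nat) :
    (forall k, (k <= m)%N -> forall n (a b : 'I_n.+2), b = (a + k.+1)%N :> nat ->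
       dissection_sum a b = w k) ->
  forall n (a b : 'I_n.+2), b = (a + m.+2)%N :> nat ->
    dissection_sum a b = texp 1 * \sum_(k < m.+1) tinv (w k) * tinv (w (m - k)%N).
Proof.
move=> wE n a b ab; rewrite dissection_sum_rec; last by rewrite ab; lia.
congr (_ * _).
rewrite -(big_mkord predT (fun k => tinv (w k) * tinv (w (m - k)%N))).
pose F l := tinv (w (l - a.+1)%N) * tinv (w (b - l.+1)%N).
(* Vertices become natural numbers, so that the range can be shifted down by [a.+1]. *)
transitivity (\sum_(a.+1 <= l < b) F l).
  rewrite big_nat (big_nat_widenl _ 0%N) //.
  rewrite (big_nat_widen _ _ n.+2) ?(ltnW (ltn_ord b)) //.
  rewrite big_mkord; apply: eq_big => [k|k /andP[ak kb]]; first by rewrite /=; lia.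
  by rewrite (wE (k - a.+1)%N) ?(wE (b - k.+1)%N) //; lia.
rewrite -[X in \sum_(X <= _ < _) _]add0n big_addn.
rewrite (_ : (b - a.+1)%N = m.+1); last by rewrite ab; lia.
apply: eq_big_nat => l /andP[_ lm].
by rewrite /F addnK; congr (_ * tinv (w _)); rewrite ab; lia.
Qed.

(** Strong induction on [m]: [wpoly (P m)] is itself a dissection sum over a full polygon, so both
    sides obey the same convolution. *)
Lemma dissection_sum_wpoly (R : realFieldType)
    (P : forall n : nat, 'I_n.+2 -> 'rV[R]_2) (hP : forall n, strictly_convex (P n))
    m n (a b : 'I_n.+2) : b = (a + m.+1)%N :> nat ->
  dissection_sum a b = wpoly (P m).
Proof.
elim/ltn_ind: m n a b => -[_|m IH] n a b ab.
  by rewrite dissection_sum_edge //= ab addn1.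
have conv := @dissection_sum_conv (fun k => wpoly (P k)) m IH.
by rewrite wpoly_dissection_sum // !conv //= add0n.
Qed.

Lemma wpoly_rec (R : realFieldType)
    (P : forall n : nat, 'I_n.+2 -> 'rV[R]_2) (hP : forall n, strictly_convex (P n)) n :
  wpoly (P n.+1) =
  texp 1 * \sum_(k < n.+1) tinv (wpoly (P k)) * tinv (wpoly (P (n - k)%N)).
Proof.
rewrite wpoly_dissection_sum //.
apply: (@dissection_sum_conv (fun k => wpoly (P k))); last by rewrite /= add0n.
by move=> k _ N a b; apply: dissection_sum_wpoly.
Qed.

Theorem theorem2p1 (R : realFieldType)
    (P : forall n : nat, 'I_n.+2 -> 'rV[R]_2)
    (hP : forall n : nat, strictly_convex (P n)) :
  let t : laurent := texp 1 in
  let w : nat -> laurent := fun n => wpoly (P n) in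
  let W : fps laurent := w in
  let x : fps laurent := fpsX in
  (w 0%N = 1 /\
   forall n : nat,
     w n.+1 = t * \sum_(k < n.+1) tinv (w k) * tinv (w (n - k)%N)) /\
  fpsC t * (1 + fpsC t * x) - fpsC t * W + 2 * fpsC t * x ^+ 2 * W ^+ 2
    + x ^+ 3 * W ^+ 4 = 0.
Proof.
move=> t w W x; split; first by split=> // n; apply: wpoly_rec.
pose V : fps laurent := fun n => tinv (w n).
have tt' : t * texp (- 1) = 1 by rewrite -texpD subrr.
have EW : W = 1 + fpsC t * (x * (V * V)).
  by apply: fps_quadratic => // n; apply: wpoly_rec.
(* Applying the involutive ring morphism [tinv] to the recurrence exchanges [W] with [V] and inverts
   [t]. *)
have EV : V = 1 + fpsC (texp (- 1)) * (x * (W * W)).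
  apply: fps_quadratic => [|n]; first exact: tinv1.
  rewrite /V /w wpoly_rec // tinvM [tinv (texp 1)]tinvU tinv_sum.
  by congr (_ * _); apply: eq_bigr => k _; rewrite tinvM !tinvK.
by apply: (fps_quartic _ EW EV); rewrite -fpsCM tt'.
Qed.
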